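(* Let $ABCD$ be a generic quadrilateral in $\mathbb{R}^2$ whose diagonal vectors $\overrightarrow{AC}$ and $\overrightarrow{BD}$ are linearly independent, and let $\mathcal{F}$ be the periodic framework associated to $ABCD$. Then $\mathcal{F}$ has a local auxetic deformation if and only if the quadrilateral $ABCD$ is in a pseudotriangle configuration.
   Context: **Quadrilaterals.** A quadrilateral $ABCD$ is a closed planar four-bar linkage with vertices $A,B,C,D\in\mathbb{R}^2$ and bars (edges) $AB, BC, CD, DA$ of positive length; it may be convex, non-convex or self-intersecting. It is called generic when the sum of its longest and shortest edge lengths is different from the sum of the other two edge lengths. **Associated periodic framework.** Let $L$ be the rank two lattice generated by $\overrightarrow{AC}$ and $\overrightarrow{BD}$. The periodic framework $\mathcal{F}$ associated to $ABCD$ is the planar bar-and-joint framework consisting of all translates of the quadrilateral by vectors in $L$, with shared vertices identified as single joints. Its periodicity group is $\Gamma\cong\mathbb{Z}^2$, acting by translations by $L$, with generators $\gamma_1,\gamma_2$ represented by $\overrightarrow{AC},\overrightarrow{BD}$. There are two vertex orbits, $A+L$ (containing $C$) and $B+L$ (containing $D$), and four edge orbits, those of $AB,BC,CD,DA$. **Deformations.** Let $V$ be the (infinite) vertex set of the underlying graph. A placement is a pair $(p,\pi)$ where $p:V\to\mathbb{R}^2$ and $\pi$ is an injective homomorphism from $\Gamma$ to the group of translations of $\mathbb{R}^2$, whose image is a lattice of rank $2$, with $p(\gamma v)=\pi(\gamma)(p(v))$ for all $v\in V$, $\gamma\in\Gamma$. A one-parameter deformation of $\mathcal{F}$ is a smooth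 family of placements $(p_\tau,\pi_\tau)$, $\tau\in(-\epsilon,\epsilon)$, of the same periodic graph, equal to the given placement at $\tau=0$, such that all edge lengths are constant in $\tau$; the lattice $\pi_\tau(\Gamma)$ may vary. Let $\Lambda_\tau$ be the $2\times2$ matrix with columns the translation vectors $\pi_\tau(\gamma_1),\pi_\tau(\gamma_2)$, and let $\omega_\tau=\Lambda_\tau^t\Lambda_\tau$ be the Gram matrix of this lattice basis. The deformation is called auxetic when $\frac{d\omega_\tau}{d\tau}$ is positive semidefinite for every $\tau\in(-\epsilon,\epsilon)$. The framework has a local auxetic deformation if, for some $\epsilon>0$, it has an auxetic one-parameter deformation that is non-trivial in the sense that $\frac{d\omega_\tau}{d\tau}\neq0$ at $\tau=0$. **Pseudotriangles.** A pseudotriangle is a simple (non-self-intersecting) planar polygon with exactly three interior angles less than $\pi$, the other interior angles being greater than $\pi$ (no interior angle equals $\pi$). The quadrilateral $ABCD$ is in a pseudotriangle configuration when it is a pseudotriangle. *)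

(* Defs.v *)
From mathcomp Require Import all_boot all_order all_algebra.
From mathcomp Require Import all_classical all_reals all_analysis.

Set Implicit Arguments.
Unset Strict Implicit.
Unset Printing Implicit Defensive.

Import Order.TTheory GRing.Theory Num.Theory.
Import numFieldNormedType.Exports.

Local Open Scope classical_set_scope.
Local Open Scope ring_scope.

(* The norm [`|_|] of the library on matrices is the sup norm, hence the
   Euclidean one below. *)
Definition dot {R : realType} (u v : 'cV[R]_2) : R := \sum_i u i 0 * v i 0.

Definition enorm {R : realType} (u : 'cV[R]_2) : R := Num.sqrt (dot u u).

Definition dist {R : realType} (P Q : 'cV[R]_2) : R := enorm (Q - P).

Definition cross {R : realType} (u v : 'cV[R]_2) : R :=
  u 0 0 * v 1 0 - u 1 0 * v 0 0.

Definition quadrilateral {R : realType} (A B C D : 'cV[R]_2) : Prop :=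
  [/\ 0 < dist A B, 0 < dist B C, 0 < dist C D & 0 < dist D A].

Definition generic {R : realType} (A B C D : 'cV[R]_2) : Prop :=
  let a := dist A B in let b := dist B C in
  let c := dist C D in let d := dist D A in
  let longest := Num.max (Num.max a b) (Num.max c d) in
  let shortest := Num.min (Num.min a b) (Num.min c d) in
  longest + shortest <> (a + b + c + d) - longest - shortest.

(* A closed polygon with [n] vertices is a map [P : 'I_n -> 'cV_2]; [ordS] and
   [ord_pred] are the cyclic successor and predecessor. *)
Definition edge_point {R : realType} n (P : 'I_n -> 'cV[R]_2) (i : 'I_n) (s : R)
    : 'cV[R]_2 :=
  P i + s *: (P (ordS i) - P i).

(* The closed curve traced by the edges is injective; each edge is taken
   without its endpoint [P (ordS i)], which is the start of the next edge. *)
Definition simple_polygon {R : realType} n (P : 'I_n -> 'cV[R]_2) : Prop :=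
  forall (i j : 'I_n) (s t : R), 0 <= s < 1 -> 0 <= t < 1 ->
    edge_point P i s = edge_point P j t -> i = j /\ s = t.

(* Shoelace formula: positive exactly when a simple polygon is traversed
   counterclockwise, that is, with its interior on the left. *)
Definition signed_area {R : realType} n (P : 'I_n -> 'cV[R]_2) : R :=
  2^-1 * \sum_i cross (P i) (P (ordS i)).

(* The angle in [0, 2 pi[ of the counterclockwise rotation taking the direction
   of [u] to that of [v], for nonzero [u] and [v]. *)
Definition ccw_angle {R : realType} (u v : 'cV[R]_2) : R :=
  let t := acos (dot u v / (enorm u * enorm v)) in
  if 0 <= cross u v then t else 2 * pi - t.

(* At a vertex of a simple polygon traversed counterclockwise, the interior is
   swept by turning counterclockwise from the outgoing to the incoming edge. *)
Definition interior_angle {R : realType} n (P : 'I_n -> 'cV[R]_2) (i : 'I_n)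
    : R :=
  let next := P (ordS i) - P i in
  let prev := P (ord_pred i) - P i in
  if 0 < signed_area P then ccw_angle next prev else ccw_angle prev next.

Definition pseudotriangle {R : realType} n (P : 'I_n -> 'cV[R]_2) : Prop :=
  [/\ simple_polygon P,
      #|[set i | interior_angle P i < pi]%SET| = 3%N &
      forall i, interior_angle P i < pi \/ pi < interior_angle P i].

Definition polygon4 {R : realType} (A B C D : 'cV[R]_2) (i : 'I_4) : 'cV[R]_2 :=
  nth 0 [:: A; B; C; D] i.

Notation Gamma := (int * int)%type.

Definition gamma1 : Gamma := (1, 0).
Definition gamma2 : Gamma := (0, 1).

(* The underlying periodic graph. The two vertex orbits are free: [VA g] and
   [VB g] are the translates by [g] of the joints [A] and [B], so that
   [C] is [VA gamma1] and [D] is [VB gamma2]. *)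
Inductive vertex : Type := VA of Gamma | VB of Gamma.

Definition act (g : Gamma) (v : vertex) : vertex :=
  match v with VA h => VA (g + h) | VB h => VB (g + h) end.

Inductive edge : vertex -> vertex -> Prop :=
| edge_AB g : edge (act g (VA 0)) (act g (VB 0))
| edge_BC g : edge (act g (VB 0)) (act g (VA gamma1))
| edge_CD g : edge (act g (VA gamma1)) (act g (VB gamma2))
| edge_DA g : edge (act g (VB gamma2)) (act g (VA 0)).

Definition rank2_lattice {R : realType} (L : set 'cV[R]_2) : Prop :=
  exists b1 b2 : 'cV[R]_2, free [:: b1; b2] /\
    L = [set x | exists m n : int, x = b1 *~ m + b2 *~ n].

(* A translation of the plane is identified with its translation vector. *)
Definition placement {R : realType}
    (p : vertex -> 'cV[R]_2) (per : Gamma -> 'cV[R]_2) : Prop :=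
  [/\ forall g h, per (g + h) = per g + per h,
      injective per,
      rank2_lattice (range per) &
      forall g v, p (act g v) = p v + per g].

Definition quad_per {R : realType} (A B C D : 'cV[R]_2) (g : Gamma)
    : 'cV[R]_2 :=
  (C - A) *~ g.1 + (D - B) *~ g.2.

Definition quad_pos {R : realType} (A B C D : 'cV[R]_2) (v : vertex)
    : 'cV[R]_2 :=
  match v with
  | VA g => A + quad_per A B C D g
  | VB g => B + quad_per A B C D g
  end.

Definition smooth_on {R : realType} (eps : R) (f : R -> R) : Prop :=
  forall (n : nat) (t : R), - eps < t < eps -> derivable (derive1n n f) t 1.

Definition deformation {R : realType} (A B C D : 'cV[R]_2) (eps : R)
    (p : R -> vertex -> 'cV[R]_2) (per : R -> Gamma -> 'cV[R]_2) : Prop :=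
  [/\ forall t, - eps < t < eps -> placement (p t) (per t),
      forall i, (forall v, smooth_on eps (fun t => p t v i 0)) /\
                (forall g, smooth_on eps (fun t => per t g i 0)),
      p 0 =1 quad_pos A B C D /\ per 0 =1 quad_per A B C D &
      forall t, - eps < t < eps -> forall u v, edge u v ->
        dist (p t u) (p t v) = dist (p 0 u) (p 0 v)].

Definition period_matrix {R : realType} (per : Gamma -> 'cV[R]_2) : 'M[R]_2 :=
  row_mx (per gamma1) (per gamma2).

Definition gram {R : realType} (per : Gamma -> 'cV[R]_2) : 'M[R]_2 :=
  (period_matrix per)^T *m period_matrix per.

Definition dgram {R : realType} (per : R -> Gamma -> 'cV[R]_2) (t : R)
    : 'M[R]_2 :=
  \matrix_(i, j) derive1 (fun s => gram (per s) i j) t.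

Definition psd {R : realType} (M : 'M[R]_2) : Prop :=
  M^T = M /\ forall x : 'cV[R]_2, 0 <= (x^T *m M *m x) 0 0.

Definition auxetic {R : realType} (eps : R) (per : R -> Gamma -> 'cV[R]_2)
    : Prop :=
  forall t, - eps < t < eps -> psd (dgram per t).

Definition has_local_auxetic_deformation {R : realType} (A B C D : 'cV[R]_2)
    : Prop :=
  exists (eps : R) (p : R -> vertex -> 'cV[R]_2) (per : R -> Gamma -> 'cV[R]_2),
    [/\ 0 < eps, deformation A B C D eps p per, auxetic eps per &
        dgram per 0 <> 0].

(* Main.v *)
(** Put e = AC, f = BD, u = AB. Keeping the four bar lengths fixed forces e.f to be
    constant, so a deformation is auxetic exactly when both squared diagonals
    E = |e|^2 and F = |f|^2 are nondecreasing. The Gram determinant of the dependent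
    vectors u, e, f is a polynomial relation between E and F, and differentiating
    it gives
      [ABD] [CBD] E' + [ABC] [ACD] F' = 0   (up to signs),
    where the products of oriented triangle areas record which diagonal crosses the
    line of the other. Hence E and F can grow together exactly when the product of
    the four turns at the vertices is negative, which for a quadrilateral means
    that it has exactly one reflex vertex. If one of the areas vanishes, the Gram
    relation to second order shows that no nontrivial monotone motion exists.
    Conversely, when no area vanishes, BD can be used as a local parameter. *)
Require Import Defs.
From mathcomp Require Import all_boot all_order all_algebra.
From mathcomp Require Import all_classical all_reals all_analysis.
From mathcomp Require Import ring lra.

Set Implicit Arguments.
Unset Strict Implicit.
Unset Printing Implicit Defensive.

Import Order.TTheory GRing.Theory Num.Theory.
Import numFieldNormedType.Exports.

Local Open Scope ring_scope.

(** * Plane vectors and angles *)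

Section PlaneVectors.
Variable R : realType.
Implicit Types u v w z : 'cV[R]_2.

Lemma sum_ord2 (F : 'I_2 -> R) : \sum_i F i = F 0 + F 1.
Proof.
rewrite !big_ord_recl big_ord0 addr0.
by have -> : lift ord0 ord0 = 1 :> 'I_2 by apply/val_inj.
Qed.

Lemma forall_ord2 (Q : 'I_2 -> Prop) : Q 0 -> Q 1 -> forall i, Q i.
Proof.
move=> q0 q1 [[|[|//]] hi].
- by rewrite (_ : Ordinal hi = 0) //; exact/val_inj.
- by rewrite (_ : Ordinal hi = 1) //; exact/val_inj.
Qed.

Lemma dotE u v : dot u v = u 0 0 * v 0 0 + u 1 0 * v 1 0.
Proof. exact: sum_ord2. Qed.

Lemma cV2P u v : u 0 0 = v 0 0 -> u 1 0 = v 1 0 -> u = v.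
Proof.
move=> h0 h1; apply/matrixP => i j; rewrite (ord1 j).
by move: i; exact: forall_ord2.
Qed.

Lemma dot_ge0 u : 0 <= dot u u.
Proof. rewrite dotE; nra. Qed.

Lemma dot_eq0 u : dot u u = 0 -> u = 0.
Proof. by rewrite dotE => h; apply: cV2P; rewrite mxE; nra. Qed.

Lemma dot_gt0 u : u != 0 -> 0 < dot u u.
Proof.
by move=> u0; rewrite lt_def dot_ge0 andbT; apply: contra_neq u0 => /dot_eq0.
Qed.

Lemma lagrange_identity u v : dot u v ^+ 2 + cross u v ^+ 2 = dot u u * dot v v.
Proof. rewrite !dotE /cross; ring. Qed.

Lemma cross_eq0_colinear u v :
  v != 0 -> cross u v = 0 -> u = (dot u v / dot v v) *: v.
Proof.
move=> /dot_gt0 v0 h.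
suff H : dot v v *: u = dot u v *: v.
  by rewrite mulrC -scalerA -H scalerA mulVf ?scale1r // gt_eqF.
apply: cV2P; rewrite !mxE !dotE.
- rewrite /cross in h; transitivity (v 0 0 * (u 0 0 * v 0 0 + u 1 0 * v 1 0) +
    v 1 0 * (u 0 0 * v 1 0 - u 1 0 * v 0 0)); first ring.
  by rewrite h; ring.
- rewrite /cross in h; transitivity (v 1 0 * (u 0 0 * v 0 0 + u 1 0 * v 1 0) -
    v 0 0 * (u 0 0 * v 1 0 - u 1 0 * v 0 0)); first ring.
  by rewrite h; ring.
Qed.

Lemma free_cross u v : free [:: u; v] = (cross u v != 0).
Proof.
rewrite free_cons seq1_free span_seq1; have [->|v0] /= := eqVneq v 0.
  by rewrite andbF /cross !mxE !mulr0 subrr eqxx.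
rewrite andbT; congr (~~ _); apply/idP/eqP => [/vlineP[k ->]|h].
  by rewrite /cross !mxE; ring.
by apply/vlineP; exists (dot u v / dot v v); exact: cross_eq0_colinear.
Qed.

Lemma cross_trans u v w : w != 0 -> cross u w = 0 -> cross w v = 0 ->
  cross u v = 0.
Proof.
move=> w0 /(cross_eq0_colinear w0) -> h.
transitivity ((dot u w / dot w w) * cross w v); last by rewrite h mulr0.
by rewrite /cross !mxE; ring.
Qed.

(** * Euclidean norms and angles compared with a straight angle *)

Lemma enorm_sqr u : enorm u ^+ 2 = dot u u.
Proof. by rewrite sqr_sqrtr // dot_ge0. Qed.

Lemma enorm_gt0 u : u != 0 -> 0 < enorm u.
Proof. by move=> /dot_gt0 u0; rewrite sqrtr_gt0. Qed.

Lemma dist_gt0 u v : 0 < dist u v -> v - u != 0.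
Proof.
apply: contraTneq; rewrite /dist => ->.
by rewrite /enorm dotE !mxE !mulr0 addr0 sqrtr0 ltxx.
Qed.

Lemma dist_eq_dot u v w z : dist u v = dist w z ->
  dot (v - u) (v - u) = dot (z - w) (z - w).
Proof. by rewrite -!enorm_sqr /dist => ->. Qed.

(** Divided by the squared norms, Lagrange's identity reads cos^2 = 1 - sin^2. So [acos] is
    evaluated inside its domain, and the extreme cosines occur only for parallel vectors. *)
Lemma cos_angle_bound u v : u != 0 -> v != 0 ->
  let c := dot u v / (enorm u * enorm v) in
  -1 <= c <= 1 /\ (c ^+ 2 = 1 <-> cross u v = 0).
Proof.
move=> u0 v0 c.
have n0 : 0 < (enorm u * enorm v) by rewrite mulr_gt0 ?enorm_gt0.
have cE : c ^+ 2 = 1 - cross u v ^+ 2 / (enorm u * enorm v) ^+ 2.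
  have -> : c ^+ 2 = dot u v ^+ 2 / (enorm u * enorm v) ^+ 2.
    by rewrite exprMn exprVn.
  have -> : dot u v ^+ 2 = (enorm u * enorm v) ^+ 2 - cross u v ^+ 2.
    by rewrite exprMn !enorm_sqr -lagrange_identity addrK.
  by rewrite mulrBl divff // expf_neq0 // gt_eqF.
have q0 : 0 <= cross u v ^+ 2 / (enorm u * enorm v) ^+ 2.
  by rewrite divr_ge0 ?sqr_ge0.
split; first by apply/andP; split; nra.
rewrite cE; split => [h|->]; last by rewrite expr0n mul0r subr0.
have /eqP : cross u v ^+ 2 / (enorm u * enorm v) ^+ 2 = 0 by lra.
by rewrite mulf_eq0 invr_eq0 !sqrf_eq0 (gt_eqF n0) orbF => /eqP.
Qed.

Lemma ccw_angle_lt_pi u v : 0 < cross u v -> ccw_angle u v < pi.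
Proof.
move=> h.
have u0 : u != 0.
  by apply: contraTneq h => ->; rewrite /cross !mxE !mul0r subrr ltxx.
have v0 : v != 0.
  by apply: contraTneq h => ->; rewrite /cross !mxE !mulr0 subrr ltxx.
have [/andP[c1 c2] hc] := cos_angle_bound u0 v0.
rewrite /ccw_angle ltW //; apply: acos_ltpi; rewrite lt_def c1 c2 !andbT.
apply/eqP => c1E; have [H _] := hc; move: h; rewrite H ?ltxx //.
by rewrite c1E sqrrN expr1n.
Qed.

(** Here the angle is 2 pi minus an arc cosine, and that arc cosine stays below pi because a cosine
    of -1 would make the cross product vanish. *)
Lemma ccw_angle_gt_pi u v : cross u v < 0 -> pi < ccw_angle u v.
Proof.
move=> h.
have h' : 0 < cross u (- v) by move: h; rewrite /cross !mxE; lra.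
have u0 : u != 0.
  by apply: contraTneq h => ->; rewrite /cross !mxE !mul0r subrr ltxx.
have v0 : v != 0.
  by apply: contraTneq h => ->; rewrite /cross !mxE !mulr0 subrr ltxx.
have [/andP[c1 c2] hc] := cos_angle_bound u0 v0.
rewrite /ccw_angle leNgt h /=.
have : acos (dot u v / (enorm u * enorm v)) < pi; last by lra.
apply: acos_ltpi; rewrite lt_def c1 c2 !andbT.
apply/eqP => c1E; have [H _] := hc; move: h; rewrite H ?ltxx //.
by rewrite c1E sqrrN expr1n.
Qed.

Lemma ccw_angle_colinear u v : u != 0 -> v != 0 -> cross u v = 0 ->
  dot u v < 0 -> ccw_angle u v = pi.
Proof.
move=> u0 v0 h d; rewrite /ccw_angle h lexx.
have [/andP[c1 c2] [_ /(_ h)]] := cos_angle_bound u0 v0.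
move=> /eqP; rewrite sqrf_eq1 => /orP[]/eqP; last by move=> ->; rewrite acosN1.
suff : dot u v / (enorm u * enorm v) < 0 by move=> + H; rewrite H ltr10.
by rewrite ltr_pdivrMr ?mul0r // mulr_gt0 ?enorm_gt0.
Qed.

End PlaneVectors.

(** * Turns and interior angles of polygons *)

Section Polygons.
Variable R : realType.

(** Twice the signed area of the triangle formed by a vertex and its two neighbours, positive at a
    left turn. *)
Definition turn n (P : 'I_n -> 'cV[R]_2) (i : 'I_n) : R :=
  cross (P (ordS i) - P i) (P (ord_pred i) - P i).

Lemma cross_anti (u v : 'cV[R]_2) : cross u v = - cross v u.
Proof. rewrite /cross; ring. Qed.

(** Multiplying by the signed area removes the orientation: in a clockwise polygon both the sign of
    a turn and the order of the two edges in [interior_angle] are reversed. *)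
Lemma interior_angle_lt_pi n (P : 'I_n -> 'cV[R]_2) i :
  0 < signed_area P * turn P i -> interior_angle P i < pi.
Proof.
rewrite /interior_angle /turn => h; case: ifPn => [w|]; last rewrite -leNgt => w.
  by apply: ccw_angle_lt_pi; rewrite -(pmulr_rgt0 _ w).
apply: ccw_angle_lt_pi; rewrite cross_anti oppr_gt0.
have w' : signed_area P < 0.
  by rewrite lt_neqAle w andbT; apply: contraTneq h => ->; rewrite mul0r ltxx.
by rewrite -(nmulr_rgt0 _ w').
Qed.

Lemma interior_angle_gt_pi n (P : 'I_n -> 'cV[R]_2) i :
  signed_area P * turn P i < 0 -> pi < interior_angle P i.
Proof.
rewrite /interior_angle /turn => h; case: ifPn => [w|]; last rewrite -leNgt => w.
  by apply: ccw_angle_gt_pi; rewrite -(pmulr_rlt0 _ w).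
apply: ccw_angle_gt_pi; rewrite cross_anti oppr_lt0.
have w' : signed_area P < 0.
  by rewrite lt_neqAle w andbT; apply: contraTneq h => ->; rewrite mul0r ltxx.
by rewrite -(nmulr_rlt0 _ w').
Qed.

(** If the two parallel edges left the vertex in the same direction, they would overlap, against
    simplicity. *)
Lemma simple_polygon_dot_le0 n (P : 'I_n -> 'cV[R]_2) i :
  simple_polygon P -> ord_pred i != i -> P (ordS i) != P i -> turn P i = 0 ->
  dot (P (ordS i) - P i) (P (ord_pred i) - P i) <= 0.
Proof.
move=> simple pi_i; rewrite -subr_eq0 => next0 t0.
rewrite leNgt; apply/negP => d0.
set next := P (ordS i) - P i in next0 t0 d0 *.
set prev := P (ord_pred i) - P i in t0 d0 *.
have prevE : prev = (dot prev next / dot next next) *: next.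
  by apply: cross_eq0_colinear; rewrite // cross_anti [cross _ _]t0 oppr0.
set c := dot prev next / dot next next in prevE.
have c0 : 0 < c.
  by rewrite divr_gt0 ?dot_gt0 //; move: d0; rewrite !dotE; lra.
(* The common point is P i + m prev = P i + c m next. This [m] puts both parameters, c m on the next
   edge and 1 - m on the previous one, in [0, 1[. *)
pose m := (1 + 2 * c)^-1.
have m0 : 0 < m by rewrite invr_gt0; nra.
have mE : m * (1 + 2 * c) = 1 by rewrite mulVf // gt_eqF //; nra.
have [|||/eqP] := simple i (ord_pred i) (c * m) (1 - m).
- by apply/andP; split; nra.
- by apply/andP; split; nra.
- rewrite /edge_point ord_predK -/next.
  have -> : P (ord_pred i) = P i + prev by rewrite addrC subrK.
  by rewrite prevE; apply: cV2P; rewrite !mxE; ring.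
- by rewrite eq_sym (negPf pi_i).
Qed.

(** At a zero turn simplicity excludes edges folded onto each other, so the edges are opposite and
    the interior angle equals pi, which a pseudotriangle forbids. *)
Lemma pseudotriangle_turn_neq0 n (P : 'I_n -> 'cV[R]_2) i :
  pseudotriangle P -> ord_pred i != i -> P (ordS i) != P i ->
  P (ord_pred i) != P i -> turn P i != 0.
Proof.
move=> [simple _ angles] pi_i next0 prev0; apply/eqP => t0.
have := simple_polygon_dot_le0 simple pi_i next0 t0.
rewrite -subr_eq0 in next0; rewrite -subr_eq0 in prev0.
set next := P (ordS i) - P i in next0 t0 *.
set prev := P (ord_pred i) - P i in t0 prev0 *.
rewrite le_eqVlt => /orP[/eqP d0|d0].
  have := lagrange_identity next prev.
  rewrite d0 [cross _ _]t0 expr0n addr0.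
  by move=> /eqP; rewrite eq_sym mulf_eq0 !gt_eqF // dot_gt0.
have : interior_angle P i = pi.
  rewrite /interior_angle; case: ifP => _; apply: ccw_angle_colinear => //.
    by rewrite cross_anti [cross _ _]t0 oppr0.
  by move: d0; rewrite !dotE /prev /next; lra.
by case: (angles i) => + H; rewrite H ltxx.
Qed.

(** The two edges lie on distinct lines, which meet only at the shared vertex; the first edge
    reaches it at s = 1, which is excluded. *)
Lemma adjacent_edges_disjoint n (P : 'I_n -> 'cV[R]_2) (i : 'I_n) (s t : R) :
  turn P (ordS i) != 0 -> s < 1 -> edge_point P i s <> edge_point P (ordS i) t.
Proof.
rewrite /turn /edge_point ordSK => h s1 /matrixP E.
set A := P i in h E; set B := P (ordS i) in h E; set C := P _ in h E.
have := E 0 0; have := E 1 0; rewrite !mxE => h1 h0.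
have : (1 - s) * cross (C - B) (A - B) = 0.
  rewrite /cross !mxE.
  transitivity ((B 0 0 - (A 0 0 + s * (B 0 0 - A 0 0))) * (C 1 0 - B 1 0)
   - (B 1 0 - (A 1 0 + s * (B 1 0 - A 1 0))) * (C 0 0 - B 0 0)); first ring.
  by rewrite h1 h0; ring.
by move=> /eqP; rewrite mulf_eq0 (negPf h) orbF subr_eq0 => /eqP; lra.
Qed.

(** The map X -> cross (B - A) (X - A) is affine and vanishes on the line AB; on the segment CD it
    is a convex combination of two numbers of the same sign. *)
Lemma same_side_disjoint (A B C D : 'cV[R]_2) (s t : R) :
  0 < cross (B - A) (C - A) * cross (B - A) (D - A) ->
  0 <= t < 1 -> A + s *: (B - A) <> C + t *: (D - C).
Proof.
move=> h /andP[t0 t1] E; have /matrixP H := E; have := H 0 0; have := H 1 0.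
rewrite !mxE => h1 h0.
have : (1 - t) * cross (B - A) (C - A) + t * cross (B - A) (D - A) = 0.
  rewrite /cross !mxE.
  transitivity ((B 0 0 - A 0 0) * (C 1 0 + t * (D 1 0 - C 1 0) - A 1 0)
   - (B 1 0 - A 1 0) * (C 0 0 + t * (D 0 0 - C 0 0) - A 0 0)); first ring.
  by rewrite -h1 -h0; ring.
move: h; set x := cross _ _; set y := cross _ _ => h.
have [x0|x0|x0] := ltgtP x 0.
- have : y < 0 by nra.
  by nra.
- have : 0 < y by nra.
  by nra.
- by rewrite x0 mul0r ltxx in h.
Qed.

(** The first two turns tell the sides of D and C with respect to AB, the last two those of B and A
    with respect to CD. A negative product makes one of these pairs lie on a single side. *)
Lemma opposite_edges_disjoint (A B C D : 'cV[R]_2) (s t : R) :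
  cross (B - A) (D - A) * cross (C - B) (A - B) *
  cross (D - C) (B - C) * cross (A - D) (C - D) < 0 ->
  0 <= s < 1 -> 0 <= t < 1 -> A + s *: (B - A) <> C + t *: (D - C).
Proof.
move=> h hs ht.
have [p|p] := ltP 0 (cross (B - A) (C - A) * cross (B - A) (D - A)).
  exact: same_side_disjoint.
apply/nesym; apply: same_side_disjoint => //.
have e1 : cross (C - B) (A - B) = cross (B - A) (C - A).
  by rewrite /cross !mxE; ring.
have e2 : cross (A - D) (C - D) = cross (D - C) (A - C).
  by rewrite /cross !mxE; ring.
by move: h p; rewrite e1 e2 -mulrA; move: (cross _ _) => x; nra.
Qed.

End Polygons.

(** * Quadrilaterals *)

Section Quadrilaterals.
Variable R : realType.

(** Each of the pairs x, z and y, w has at most one negative member, so at most two numbers are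
    negative, and a negative product means exactly one. *)
Lemma three_positive (S x y z w : R) : 0 < S -> x + z = S -> y + w = S ->
  x != 0 -> y != 0 -> z != 0 -> w != 0 ->
  (((0 < x)%R + (0 < y)%R + (0 < z)%R + (0 < w)%R)%N == 3) = (x * y * z * w < 0).
Proof.
move=> S0 xz yw x0 y0 z0 w0; rewrite !(mulr_lt0, mulf_eq0).
rewrite (negPf x0) (negPf y0) (negPf z0) (negPf w0) /=.
move: x0 y0 z0 w0; case: (ltgtP x 0) => // x0 _; case: (ltgtP y 0) => // y0 _;
  case: (ltgtP z 0) => // z0 _; case: (ltgtP w 0) => // w0 _ /=; lra.
Qed.

Lemma forall_ord4 (Q : 'I_4 -> Prop) :
  Q 0 -> Q 1 -> Q (inord 2) -> Q (inord 3) -> forall i, Q i.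
Proof.
move=> q0 q1 q2 q3 [[|[|[|[|//]]]] hi].
- by rewrite (_ : Ordinal hi = 0) //; exact/val_inj.
- by rewrite (_ : Ordinal hi = 1) //; exact/val_inj.
- by rewrite (_ : Ordinal hi = inord 2) //; apply/val_inj; rewrite /= inordK.
- by rewrite (_ : Ordinal hi = inord 3) //; apply/val_inj; rewrite /= inordK.
Qed.

Lemma big_ord4 (T : Type) (idx : T) (op : Monoid.law idx) (F : 'I_4 -> T) :
  \big[op/idx]_i F i = op (op (op (F 0) (F 1)) (F (inord 2))) (F (inord 3)).
Proof.
rewrite !big_ord_recl big_ord0 Monoid.mulm1 !Monoid.mulmA.
by congr (op (op (op (F _) (F _)) (F _)) (F _)); apply/val_inj; rewrite /= ?inordK.
Qed.

Lemma ordS4 : (ordS 0 = 1 :> 'I_4) * (ordS 1 = inord 2 :> 'I_4) *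
  (ordS (inord 2) = inord 3 :> 'I_4) * (ordS (inord 3) = 0 :> 'I_4).
Proof. by do !split; apply/val_inj; rewrite /= ?inordK. Qed.

Lemma ord_pred4 : (ord_pred 0 = inord 3 :> 'I_4) * (ord_pred 1 = 0 :> 'I_4) *
  (ord_pred (inord 2) = 1 :> 'I_4) * (ord_pred (inord 3) = inord 2 :> 'I_4).
Proof. by do !split; apply/val_inj; rewrite /= ?inordK. Qed.

Lemma polygon4E (A B C D : 'cV[R]_2) :
  (polygon4 A B C D 0 = A) * (polygon4 A B C D 1 = B) *
  (polygon4 A B C D (inord 2) = C) * (polygon4 A B C D (inord 3) = D).
Proof. by rewrite /polygon4 !inordK. Qed.

Section FourBar.
Variables A B C D : 'cV[R]_2.
Local Notation P := (polygon4 A B C D).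
Hypotheses (quad : quadrilateral A B C D) (diag : cross (C - A) (D - B) != 0).

Lemma turn4E : (turn P 0 = cross (B - A) (D - A)) *
  (turn P 1 = cross (C - B) (A - B)) * (turn P (inord 2) = cross (D - C) (B - C)) *
  (turn P (inord 3) = cross (A - D) (C - D)).
Proof. by rewrite /turn !(ordS4, ord_pred4) !polygon4E. Qed.

(** Independent diagonals thus give every such quadrilateral, even a self-intersecting one, a
    nonzero signed area. *)
Lemma signed_area4 : signed_area P = 2^-1 * cross (C - A) (D - B).
Proof.
rewrite /signed_area big_ord4 /= !ordS4 !polygon4E; congr (_ * _).
by rewrite /cross !mxE; ring.
Qed.

Lemma polygon4_edge_neq0 i : P (ordS i) != P i.
Proof.
have [/dist_gt0 a /dist_gt0 b /dist_gt0 c /dist_gt0 d] := quad.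
by rewrite -subr_eq0; move: i; apply: forall_ord4; rewrite ordS4 !polygon4E.
Qed.

Lemma cyclic_cover4 (i j : 'I_4) :
  [\/ j = i, j = ordS i, i = ordS j | j = ordS (ordS i)].
Proof.
move: i j; apply: forall_ord4; apply: forall_ord4; rewrite !ordS4;
  by [constructor 1|constructor 2|constructor 3|constructor 4].
Qed.

Lemma simple_polygon4 : \prod_i turn P i < 0 -> simple_polygon P.
Proof.
move=> h.
have t0 i : turn P i != 0.
  by have : \prod_i turn P i != 0; [rewrite lt_eqF|move=> /prodf_neq0; apply].
have opp i s t : 0 <= s < 1 -> 0 <= t < 1 ->
    edge_point P i s <> edge_point P (ordS (ordS i)) t.
  move: h; rewrite big_ord4 /= !turn4E /edge_point => h.
  (* Starting from another vertex only permutes the four turns cyclically, which leaves their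
     product unchanged. *)
  move: i; apply: forall_ord4; rewrite !ordS4 !polygon4E => hs ht;
    apply: opposite_edges_disjoint => //; move: h; congr (is_true (_ < 0));
    ring.
have adj i s t : s < 1 -> edge_point P i s <> edge_point P (ordS i) t.
  exact: adjacent_edges_disjoint.
move=> i j s t hs ht.
case: (cyclic_cover4 i j) => [->|->|->|->].
- move=> /addrI /eqP; rewrite -subr_eq0 -scalerBl scaler_eq0 !subr_eq0.
  by rewrite (negPf (polygon4_edge_neq0 i)) orbF => /eqP.
- by move=> /adj; case/andP: hs => _ -> /(_ isT).
- by move=> /esym /adj; case/andP: ht => _ -> /(_ isT).
- by move=> /opp; move=> /(_ hs ht).
Qed.

(** Once no turn vanishes, the interior angles below pi are counted by the signs of the oriented
    turns, and three such angles amount to exactly one reflex vertex. A negative product also yields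
    simplicity. *)
Lemma pseudotriangle4 : pseudotriangle P <-> \prod_i turn P i < 0.
Proof.
have w0 : signed_area P != 0 by rewrite signed_area4 mulf_neq0 ?invr_neq0.
pose w := signed_area P.
have count : (forall i, turn P i != 0) ->
    #|[set i | interior_angle P i < pi]%SET| = 3%N <-> \prod_i turn P i < 0.
  move=> t0.
  have w4 : 0 < w ^+ 4 by rewrite exprn_even_gt0.
  have wt i : w * turn P i != 0 by rewrite mulf_neq0.
  have -> : [set i | interior_angle P i < pi]%SET = [set i | 0 < w * turn P i]%SET.
    apply/setP => i; rewrite !inE; case: (ltgtP 0 (w * turn P i)) (wt i).
    - by move=> /interior_angle_lt_pi ->.
    - by move=> /interior_angle_gt_pi H _; apply/negbTE; rewrite -leNgt ltW.
    - by [].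
  have -> : #|[set i | 0 < w * turn P i]%SET| = (\sum_i (0 < w * turn P i)%R)%N.
    by rewrite -sum1_card big_mkcond /=; apply: eq_bigr => i _; rewrite inE; case: ifP.
  (* Orienting all four turns multiplies their product by the positive number w^4. *)
  have -> : (\prod_i turn P i < 0) = (\prod_i (w * turn P i) < 0).
    rewrite !big_ord4 /=.
    transitivity (w ^+ 4 *
      (turn P 0 * turn P 1 * turn P (inord 2) * turn P (inord 3)) < 0).
      by rewrite (pmulr_rlt0 _ w4).
    by congr (_ < _); ring.
  (* A diagonal cuts the signed area into the triangles at two opposite vertices, so opposite turns
     add up to 2 w. *)
  have S0 : 0 < 2 * w ^+ 2 by rewrite mulr_gt0 // exprn_even_gt0.
  have e0 : w * turn P 0 + w * turn P (inord 2) = 2 * w ^+ 2.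
    by rewrite !turn4E /w signed_area4 /cross !mxE; field.
  have e1 : w * turn P 1 + w * turn P (inord 3) = 2 * w ^+ 2.
    by rewrite !turn4E /w signed_area4 /cross !mxE; field.
  rewrite !big_ord4 /= -(three_positive S0 e0 e1) ?wt //.
  by split => /eqP.
split=> [pt|h].
  have [_ c _] := pt; apply/count => // i.
  apply: pseudotriangle_turn_neq0 => //.
  - by move: i {pt c}; apply: forall_ord4; rewrite ord_pred4 -val_eqE /= ?inordK.
  - exact: polygon4_edge_neq0.
  - by have := polygon4_edge_neq0 (ord_pred i); rewrite ord_predK eq_sym.
have t0 i : turn P i != 0.
  by have : \prod_i turn P i != 0; [rewrite lt_eqF|move=> /prodf_neq0; apply].
split; [exact: simple_polygon4|exact/count|move=> i].
have : signed_area P * turn P i != 0 by rewrite mulf_neq0.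
rewrite neq_lt => /orP[/interior_angle_gt_pi|/interior_angle_lt_pi]; first by right.
by left.
Qed.

End FourBar.
End Quadrilaterals.

(** * Smooth functions on an interval *)

Section Smooth.
Variables (R : realType) (eps : R).
Implicit Types f g : R -> R.

(** Differentiability of order [n] on the open interval. Unlike smoothness it supports induction on
    the order, since passing to the derivative lowers it by one. *)
Definition diff_upto (n : nat) f : Prop :=
  forall m t, (m < n)%N -> - eps < t < eps -> derivable (derive1n m f) t 1.

Lemma near_interval (t : R) : - eps < t < eps -> \forall s \near t, - eps < s < eps.
Proof.
move=> ht; have := @near_in_itvoo R (- eps) eps t; rewrite in_itv /= => /(_ ht).
by apply: filterS => s; rewrite in_itv.
Qed.

Lemma derive1n_eq f g n : (forall t, - eps < t < eps -> f t = g t) ->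
  forall t, - eps < t < eps -> derive1n n f t = derive1n n g t.
Proof.
move=> fg; elim: n => [|n IH] t ht; first by rewrite !derive1n0 fg.
rewrite !derive1nS !derive1E; apply: near_eq_derive.
by apply: filterS (near_interval ht) => s; exact: IH.
Qed.

Lemma derive1_is_derive f t df : is_derive t (1 : R) f df -> derive1 f t = df.
Proof. by move=> [_ <-]; rewrite derive1E. Qed.

Lemma diff_upto_eq n f g : (forall t, - eps < t < eps -> f t = g t) ->
  diff_upto n f -> diff_upto n g.
Proof.
move=> fg hf m t mn ht; apply: near_eq_derivable (hf m t mn ht).
by apply: filterS (near_interval ht) => s; exact: derive1n_eq.
Qed.

Lemma diff_uptoS n f : diff_upto n.+1 f <->
  (forall t, - eps < t < eps -> derivable f t 1) /\ diff_upto n (derive1 f).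
Proof.
split=> [h|[h0 h] [|m] t mn ht].
- split=> [t ht|m t mn ht]; first exact: (h 0%N).
  by rewrite -derive1Sn; exact: h.
- by rewrite derive1n0; exact: h0.
- by rewrite derive1Sn; exact: h.
Qed.

Lemma diff_upto_intro n f df :
  (forall t, - eps < t < eps -> is_derive t (1 : R) f (df t)) ->
  diff_upto n df -> diff_upto n.+1 f.
Proof.
move=> h hdf; apply/diff_uptoS; split=> [t /h [] //|].
by apply: diff_upto_eq hdf => t /h /derive1_is_derive ->.
Qed.

Lemma diff_upto_elim n f : diff_upto n.+1 f ->
  [/\ diff_upto n f, diff_upto n (derive1 f) &
      forall t, - eps < t < eps -> is_derive t (1 : R) f (derive1 f t)].
Proof.
move=> h; have [h0 h1] := (diff_uptoS _ _).1 h; split.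
- by move=> m t mn; apply: h; exact: ltnW.
- exact: h1.
- by move=> t ht; rewrite derive1E; exact: derivableP (h0 t ht).
Qed.

Lemma diff_upto0 f : diff_upto 0 f.
Proof. by move=> m t; rewrite ltn0. Qed.

Lemma diff_upto_cst n (c : R) : diff_upto n (fun=> c).
Proof.
elim: n c => [|n IH] c; first exact: diff_upto0.
by apply: (diff_upto_intro (df := fun=> 0)); exact: IH.
Qed.

Lemma diff_uptoD n f g : diff_upto n f -> diff_upto n g ->
  diff_upto n (fun t => f t + g t).
Proof.
elim: n f g => [|n IH] f g hf hg; first exact: diff_upto0.
have [_ f1 fd] := diff_upto_elim hf; have [_ g1 gd] := diff_upto_elim hg.
apply: (diff_upto_intro (df := fun t => derive1 f t + derive1 g t)).
  by move=> t ht; exact: is_deriveD (fd t ht) (gd t ht).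
exact: IH f1 g1.
Qed.

Lemma diff_uptoM n f g : diff_upto n f -> diff_upto n g ->
  diff_upto n (fun t => f t * g t).
Proof.
elim: n f g => [|n IH] f g hf hg; first exact: diff_upto0.
have [f0 f1 fd] := diff_upto_elim hf; have [g0 g1 gd] := diff_upto_elim hg.
apply: (diff_upto_intro (df := fun t => f t * derive1 g t + g t * derive1 f t)).
  by move=> t ht; exact: is_deriveM (fd t ht) (gd t ht).
exact: diff_uptoD (IH _ _ f0 g1) (IH _ _ g0 f1).
Qed.

(** The derivative -f'/f^2 contains 1/f only to the lower order, which the induction hypothesis
    supplies. The square root is treated in the same way. *)
Lemma diff_uptoV n f : (forall t, - eps < t < eps -> f t != 0) ->
  diff_upto n f -> diff_upto n (fun t => (f t)^-1).
Proof.
move=> fn0; elim: n => [|n IH] hf; first exact: diff_upto0.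
have [/IH f0 f1 fd] := diff_upto_elim hf.
apply: (diff_upto_intro
  (df := fun t => (- 1) * ((f t)^-1 * (f t)^-1) * derive1 f t)).
  move=> t ht; apply: is_derive_eq; first exact: is_deriveV (fn0 t ht) (fd t ht).
  by rewrite /GRing.scale /= expr2 invfM mulN1r.
apply: diff_uptoM f1; apply: diff_uptoM (@diff_upto_cst n (- 1)) _.
exact: (diff_uptoM f0 f0).
Qed.

Lemma diff_upto_sqrt n f : (forall t, - eps < t < eps -> 0 < f t) ->
  diff_upto n f -> diff_upto n (fun t => Num.sqrt (f t)).
Proof.
move=> f_gt0; elim: n => [|n IH] hf; first exact: diff_upto0.
have [/IH f0 f1 fd] := diff_upto_elim hf.
apply: (diff_upto_intro (df := fun t => (2 * Num.sqrt (f t))^-1 * derive1 f t)).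
  by move=> t ht; exact: is_derive1_comp (is_derive1_sqrt (f_gt0 t ht)) (fd t ht).
apply: diff_uptoM f1; apply: diff_uptoV (diff_uptoM (@diff_upto_cst n 2) f0).
by move=> t ht; rewrite mulf_neq0 // gt_eqF // sqrtr_gt0 f_gt0.
Qed.

Lemma smooth_onP f : smooth_on eps f <-> forall n, diff_upto n f.
Proof. by split=> [h n m t _|h n t]; [exact: h|exact: (h n.+1)]. Qed.

Lemma smooth_on_cst (c : R) : smooth_on eps (fun=> c).
Proof. by apply/smooth_onP => n; exact: diff_upto_cst. Qed.

Lemma smooth_on_id : smooth_on eps id.
Proof.
apply/smooth_onP => -[|n]; first exact: diff_upto0.
by apply: (diff_upto_intro (df := fun=> 1));
  exact: diff_upto_cst.
Qed.

Lemma smooth_onD f g : smooth_on eps f -> smooth_on eps g ->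
  smooth_on eps (fun t => f t + g t).
Proof.
move=> hf hg; apply/smooth_onP => n.
exact: diff_uptoD ((smooth_onP f).1 hf n) ((smooth_onP g).1 hg n).
Qed.

Lemma smooth_onM f g : smooth_on eps f -> smooth_on eps g ->
  smooth_on eps (fun t => f t * g t).
Proof.
move=> hf hg; apply/smooth_onP => n.
exact: diff_uptoM ((smooth_onP f).1 hf n) ((smooth_onP g).1 hg n).
Qed.

Lemma smooth_onV f : (forall t, - eps < t < eps -> f t != 0) ->
  smooth_on eps f -> smooth_on eps (fun t => (f t)^-1).
Proof.
move=> fn0 hf; apply/smooth_onP => n.
exact: diff_uptoV fn0 ((smooth_onP f).1 hf n).
Qed.

Lemma smooth_on_sqrt f : (forall t, - eps < t < eps -> 0 < f t) ->
  smooth_on eps f -> smooth_on eps (fun t => Num.sqrt (f t)).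
Proof.
move=> f0 hf; apply/smooth_onP => n.
exact: diff_upto_sqrt f0 ((smooth_onP f).1 hf n).
Qed.

Lemma smooth_on_is_derive f t : smooth_on eps f -> - eps < t < eps ->
  is_derive t (1 : R) f (derive1 f t).
Proof.
by move=> hf; have [_ _] := diff_upto_elim ((smooth_onP f).1 hf 1%N); apply.
Qed.

Lemma smooth_on_derive1 f : smooth_on eps f -> smooth_on eps (derive1 f).
Proof.
move=> hf; apply/smooth_onP => n.
by have [_ h _] := diff_upto_elim ((smooth_onP f).1 hf n.+1).
Qed.

Lemma smooth_on_eq f g : (forall t, - eps < t < eps -> f t = g t) ->
  smooth_on eps f -> smooth_on eps g.
Proof.
move=> fg hf; apply/smooth_onP => n.
exact: diff_upto_eq fg ((smooth_onP f).1 hf n).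
Qed.

End Smooth.

(** * The Gram relation between the squared diagonals *)

Section GramCurve.
Variable R : realType.

(** Gram determinant of u, e, f with a2 = |u|^2, E = |e|^2, F = |f|^2 and k = e.f. The other
    products are u.e = (E - al) / 2 and u.f = (be - F) / 2, where al = |e - u|^2 - a2 and be = |u +
    f|^2 - a2. *)
Definition gramdet (a2 al be k E F : R) : R :=
  a2 * (E * F - k * k) - 4^-1 * (E - al) * (E - al) * F
  - 2^-1 * (E - al) * (F - be) * k - 4^-1 * (F - be) * (F - be) * E.

(** Partial derivative of [gramdet] in E. By symmetry the one in F arises by exchanging E with F and
    [al] with [be]. *)
Definition dgramdet (a2 al be k E F : R) : R :=
  a2 * F - 2^-1 * (E - al) * F - 2^-1 * (F - be) * k
  - 4^-1 * (F - be) * (F - be).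

Lemma is_deriveD_fun (f g : R -> R) t df dg :
  is_derive t (1 : R) f df -> is_derive t (1 : R) g dg ->
  is_derive t (1 : R) (fun s => f s + g s) (df + dg).
Proof. exact: is_deriveD. Qed.

Lemma is_deriveM_fun (f g : R -> R) t df dg :
  is_derive t (1 : R) f df -> is_derive t (1 : R) g dg ->
  is_derive t (1 : R) (fun s => f s * g s) (f t * dg + g t * df).
Proof. exact: is_deriveM. Qed.

Lemma is_derive_gramdet (a2 al be k : R) (E F : R -> R) t dE dF :
  is_derive t (1 : R) E dE -> is_derive t (1 : R) F dF ->
  is_derive t (1 : R) (fun s => gramdet a2 al be k (E s) (F s))
    (dgramdet a2 al be k (E t) (F t) * dE + dgramdet a2 be al k (F t) (E t) * dF).
Proof.
move=> hE hF; rewrite /gramdet /dgramdet; apply: is_derive_eq.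
by rewrite /GRing.scale /=; field.
Qed.

Lemma is_derive_dgramdet (a2 al be k : R) (E F : R -> R) t dE dF :
  is_derive t (1 : R) E dE -> is_derive t (1 : R) F dF ->
  is_derive t (1 : R) (fun s => dgramdet a2 al be k (E s) (F s))
    (- (2^-1 * F t) * dE +
     (a2 - 2^-1 * (E t - al) - 2^-1 * k - 2^-1 * (F t - be)) * dF).
Proof.
move=> hE hF; rewrite /dgramdet; apply: is_derive_eq.
by rewrite /GRing.scale /=; field.
Qed.

Lemma derive_locally_cst (eps : R) (f : R -> R) (c : R) t :
  (forall s, - eps < s < eps -> f s = c) -> - eps < t < eps ->
  is_derive t (1 : R) f 0.
Proof.
move=> fc ht; apply: near_eq_is_derive (is_derive_cst c t 1).
by apply: filterS (near_interval ht) => s /fc ->.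
Qed.

Section Deformation.
Variables (eps a2 al be k : R) (E F : R -> R).
Hypotheses (eps0 : 0 < eps) (sE : smooth_on eps E) (sF : smooth_on eps F).
Hypothesis (EF : forall t, - eps < t < eps -> gramdet a2 al be k (E t) (F t) = 0).

Lemma gramdet_tangent t : - eps < t < eps ->
  dgramdet a2 al be k (E t) (F t) * derive1 E t +
  dgramdet a2 be al k (F t) (E t) * derive1 F t = 0.
Proof.
move=> ht; have d := is_derive_gramdet a2 al be k
  (smooth_on_is_derive sE ht) (smooth_on_is_derive sF ht).
by rewrite -(derive1_is_derive d) (derive1_is_derive (derive_locally_cst EF ht)).
Qed.

(** A nonnegative F' that vanishes at 0 has an interior minimum there, so its own derivative is
    zero. *)
Lemma stationary_derive2 :
  (forall t, - eps < t < eps -> 0 <= derive1 F t) -> derive1 F 0 = 0 ->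
  is_derive (0 : R) (1 : R) (derive1 F) 0.
Proof.
move=> F_ge0 F0; apply: (@derive1_at_min _ _ (- eps) eps).
- by rewrite !(gt0_cp eps0).
- move=> t; rewrite in_itv /= => ht.
  by have [] := smooth_on_is_derive (smooth_on_derive1 sF) ht.
- by rewrite in_itv /= oppr_lt0 eps0.
- by move=> t; rewrite in_itv /= F0 => /F_ge0.
Qed.

(* The second-order term at a stationary point of F is -F E'^2 / 2. *)
Lemma stationary_gramdet :
  (forall t, - eps < t < eps -> 0 <= derive1 F t) -> F 0 != 0 ->
  dgramdet a2 al be k (E 0) (F 0) = 0 -> derive1 F 0 = 0 -> derive1 E 0 = 0.
Proof.
move=> F_ge0 Fn0 dE0 F0; have h0 : - eps < 0 < eps by rewrite oppr_lt0 eps0.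
have hE := smooth_on_is_derive sE h0; have hF := smooth_on_is_derive sF h0.
have hE2 := smooth_on_is_derive (smooth_on_derive1 sE) h0.
have hF2 := stationary_derive2 F_ge0 F0.
(* The tangent relation is differentiated once more; the terms carrying the E-partial, F' or F''
   vanish at 0. *)
have d := is_deriveD_fun (is_deriveM_fun (is_derive_dgramdet a2 al be k hE hF) hE2)
  (is_deriveM_fun (is_derive_dgramdet a2 be al k hF hE) hF2).
have := derive1_is_derive d.
rewrite (derive1_is_derive (derive_locally_cst gramdet_tangent h0)) dE0 F0.
rewrite !(mul0r, mulr0, addr0, add0r) => /esym /eqP.
by rewrite !(mulf_eq0, oppr_eq0, invr_eq0) (negPf Fn0) pnatr_eq0 /= orbb => /eqP.
Qed.

End Deformation.

Lemma gramdet_sym (a2 al be k E F : R) :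
  gramdet a2 be al k F E = gramdet a2 al be k E F.
Proof. rewrite /gramdet; ring. Qed.

(** With p and q the partials at 0, the tangent relation is p E' + q F' = 0, where E' and F' are
    nonnegative and not both zero. Partials of the same sign would force both to vanish; a zero
    partial is excluded at second order. *)
Lemma auxetic_opposite (eps a2 al be k : R) (E F : R -> R) :
  0 < eps -> smooth_on eps E -> smooth_on eps F ->
  (forall t, - eps < t < eps -> gramdet a2 al be k (E t) (F t) = 0) ->
  (forall t, - eps < t < eps -> 0 <= derive1 E t /\ 0 <= derive1 F t) ->
  E 0 != 0 -> F 0 != 0 ->
  dgramdet a2 al be k (E 0) (F 0) != 0 \/ dgramdet a2 be al k (F 0) (E 0) != 0 ->
  derive1 E 0 != 0 \/ derive1 F 0 != 0 ->
  dgramdet a2 al be k (E 0) (F 0) * dgramdet a2 be al k (F 0) (E 0) < 0.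
Proof.
move=> eps0 sE sF EF mono En0 Fn0 sing nontriv.
have FE t : - eps < t < eps -> gramdet a2 be al k (F t) (E t) = 0.
  by rewrite gramdet_sym; exact: EF.
have h0 : - eps < 0 < eps by rewrite oppr_lt0 eps0.
have := gramdet_tangent sE sF EF h0.
have := @stationary_gramdet _ _ _ _ _ _ _ eps0 sE sF EF (fun t ht => (mono t ht).2) Fn0.
have := @stationary_gramdet _ _ _ _ _ _ _ eps0 sF sE FE (fun t ht => (mono t ht).1) En0.
have [] := mono 0 h0; move: sing nontriv.
move: (dgramdet a2 al be k (E 0) (F 0)) (dgramdet a2 be al k (F 0) (E 0)) => p q.
move: (derive1 E 0) (derive1 F 0) => x y.
move=> sing nontriv x0 y0 hq hp T.
(* If p = 0, then q is nonzero, so F' = 0, and the second-order argument gives E' = 0 as well. *)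
have [p0|pn0] := eqVneq p 0.
  have qn0 : q != 0 by case: sing; rewrite ?p0 ?eqxx.
  have y_0 : y = 0.
    by move: T => /eqP; rewrite p0 mul0r add0r mulf_eq0 (negPf qn0) => /eqP.
  by case: nontriv; rewrite ?y_0 ?(hp p0 y_0) eqxx.
have [q0|qn0] := eqVneq q 0.
  have x_0 : x = 0.
    by move: T => /eqP; rewrite q0 mul0r addr0 mulf_eq0 (negPf pn0) => /eqP.
  by case: nontriv; rewrite ?x_0 ?(hq q0 x_0) eqxx.
rewrite ltNge; apply/negP => pq.
have pq0 : 0 < p * q by rewrite lt_def mulf_neq0.
case: nontriv => /eqP; apply; first nra.
nra.
Qed.

End GramCurve.

(** * Infinitesimal motions of the four-bar linkage *)

Section Deformations.
Variable R : realType.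
Implicit Types u v e f z : 'cV[R]_2.

(** Three plane vectors are dependent, whence the zero determinant. With u = AB, e = AC, f = BD, the
    E-partial vanishes when A or C is on the line BD, the F-partial when B or D is on the line AC.
    The last identity expresses e.f by the four bar lengths. *)
Lemma gram_identities u e f (a2 := dot u u) (al := dot (e - u) (e - u) - a2)
    (be := dot (u + f) (u + f) - a2) (k := dot e f) :
  [/\ gramdet a2 al be k (dot e e) (dot f f) = 0,
      dgramdet a2 al be k (dot e e) (dot f f) = cross u f * cross (u - e) f,
      dgramdet a2 be al k (dot f f) (dot e e) = cross e u * cross e (u + f) &
      k = 2^-1 * (a2 + al + be - dot (u + f - e) (u + f - e))].
Proof.
by rewrite /gramdet /dgramdet /al /be /k /a2 /cross !dotE !mxE; split; field.
Qed.

Lemma common_parallel z e f : z != 0 -> cross e f != 0 ->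
  cross z f = 0 -> cross e z != 0.
Proof. by move=> z0 + zf; apply: contra_neq => ez; exact: cross_trans z0 ez zf. Qed.

(** If A or C lies on the line BD, two bars at that vertex are parallel to f; being nonzero, they
    are not parallel to e, so neither B nor D lies on the line AC. *)
Lemma dgramdet_nonsingular u e f : cross e f != 0 -> u != 0 -> e - u != 0 ->
  u + f != 0 -> u + f - e != 0 ->
  cross u f * cross (u - e) f != 0 \/ cross e u * cross e (u + f) != 0.
Proof.
move=> ef u0 eu0 uf0 ufe0.
have ue0 : u - e != 0 by rewrite -oppr_eq0 opprB.
have [|] := eqVneq (cross u f * cross (u - e) f) 0; last by left.
move=> /eqP; rewrite mulf_eq0 => /orP[/eqP X0|/eqP X0]; right; rewrite mulf_neq0 //.
- exact: common_parallel X0.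
- apply: (@common_parallel _ _ f) => //.
  by rewrite -X0 /cross !mxE; ring.
- have := common_parallel ue0 ef X0; congr (_ != _).
  by rewrite /cross !mxE; ring.
- have : cross (u + f - e) f = 0 by rewrite -X0 /cross !mxE; ring.
  move=> /(common_parallel ufe0 ef); congr (_ != _).
  by rewrite /cross !mxE; ring.
Qed.

(** The turns at A and C are the factors of the E-partial, those at B and D the factors of the
    F-partial, up to two signs that cancel. *)
Lemma turns_dgramdet (A B C D : 'cV[R]_2)
    (u := B - A) (e := C - A) (f := D - B) :
  \prod_i turn (polygon4 A B C D) i =
  cross u f * cross (u - e) f * (cross e u * cross e (u + f)).
Proof.
by rewrite big_ord4 /= !turn4E /u /e /f /cross !mxE; ring.
Qed.

(** * Entries of the Gram matrix and semidefiniteness *)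

Lemma period_matrixE (per : Gamma -> 'cV[R]_2) i :
  (period_matrix per i 0 = per gamma1 i 0) * (period_matrix per i 1 = per gamma2 i 0).
Proof.
by split; rewrite mxE; case: splitP => // j; rewrite (ord1 j).
Qed.

Lemma gramE (per : Gamma -> 'cV[R]_2) :
  (gram per 0 0 = dot (per gamma1) (per gamma1)) *
  (gram per 0 1 = dot (per gamma1) (per gamma2)) *
  (gram per 1 0 = dot (per gamma1) (per gamma2)) *
  (gram per 1 1 = dot (per gamma2) (per gamma2)).
Proof.
rewrite /gram; do !split; rewrite mxE sum_ord2 ![_^T _ _]mxE !period_matrixE dotE //.
by congr (_ + _); exact: mulrC.
Qed.

Lemma dgramE (per : R -> Gamma -> 'cV[R]_2) t i j :
  dgram per t i j = derive1 (fun s => gram (per s) i j) t.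
Proof. by rewrite mxE. Qed.

Lemma quadratic_formE (M : 'M[R]_2) (x : 'cV[R]_2) :
  (x^T *m M *m x) 0 0 = x 0 0 ^+ 2 * M 0 0 + x 0 0 * x 1 0 * (M 0 1 + M 1 0)
    + x 1 0 ^+ 2 * M 1 1.
Proof.
by rewrite !mxE sum_ord2 !mxE !sum_ord2 !mxE; ring.
Qed.

Lemma psd_diag_ge0 (M : 'M[R]_2) : psd M -> 0 <= M 0 0 /\ 0 <= M 1 1.
Proof.
move=> [_ h]; split.
  by have := h (delta_mx 0 0); rewrite quadratic_formE !mxE /=; lra.
by have := h (delta_mx 1 0); rewrite quadratic_formE !mxE /=; lra.
Qed.

Lemma mx2P (M N : 'M[R]_2) : M 0 0 = N 0 0 -> M 0 1 = N 0 1 -> M 1 0 = N 1 0 ->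
  M 1 1 = N 1 1 -> M = N.
Proof.
by move=> h00 h01 h10 h11; apply/matrixP; do 2!apply: forall_ord2.
Qed.

Lemma psd_diag (M : 'M[R]_2) : M 0 1 = 0 -> M 1 0 = 0 -> 0 <= M 0 0 -> 0 <= M 1 1 ->
  psd M.
Proof.
move=> h01 h10 h0 h1; split; first by apply: mx2P; rewrite !mxE // h01 h10.
move=> x; rewrite quadratic_formE h01 h10 addr0 mulr0 addr0.
by rewrite addr_ge0 // mulr_ge0 // sqr_ge0.
Qed.

Definition smooth_vec (eps : R) (z : R -> 'cV[R]_2) : Prop :=
  forall i, smooth_on eps (fun t => z t i 0).

Lemma smooth_on_dot eps (y z : R -> 'cV[R]_2) : smooth_vec eps y ->
  smooth_vec eps z -> smooth_on eps (fun t => dot (y t) (z t)).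
Proof.
move=> hy hz; apply: (smooth_on_eq (f := fun t => y t 0 0 * z t 0 0 + y t 1 0 * z t 1 0)).
  by move=> t _; rewrite dotE.
exact: (smooth_onD (smooth_onM (hy 0) (hz 0)) (smooth_onM (hy 1) (hz 1))).
Qed.

(** * The squared diagonals along a motion preserving the bar lengths *)

Section Flex.
Variables (eps : R) (u e f : R -> 'cV[R]_2).
Hypotheses (se : smooth_vec eps e) (sf : smooth_vec eps f).
Let E t := dot (e t) (e t).
Let F t := dot (f t) (f t).
Let a2 := dot (u 0) (u 0).
Let al := dot (e 0 - u 0) (e 0 - u 0) - a2.
Let be := dot (u 0 + f 0) (u 0 + f 0) - a2.
Let k := dot (e 0) (f 0).
Hypothesis rigid : forall t, - eps < t < eps ->
  [/\ dot (u t) (u t) = dot (u 0) (u 0),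
      dot (e t - u t) (e t - u t) = dot (e 0 - u 0) (e 0 - u 0),
      dot (u t + f t - e t) (u t + f t - e t) =
        dot (u 0 + f 0 - e 0) (u 0 + f 0 - e 0) &
      dot (u t + f t) (u t + f t) = dot (u 0 + f 0) (u 0 + f 0)].

Lemma flex_dot_cst t : - eps < t < eps -> dot (e t) (f t) = k.
Proof.
move=> /rigid[h1 h2 h3 h4].
have [_ _ _ ->] := gram_identities (u t) (e t) (f t).
by have [_ _ _ ] := gram_identities (u 0) (e 0) (f 0); rewrite h1 h2 h3 h4 => <-.
Qed.

Lemma flex_gramdet t : - eps < t < eps ->
  [/\ gramdet a2 al be k (E t) (F t) = 0,
      dgramdet a2 al be k (E t) (F t) = cross (u t) (f t) * cross (u t - e t) (f t) &
      dgramdet a2 be al k (F t) (E t) = cross (e t) (u t) * cross (e t) (u t + f t)].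
Proof.
move=> ht; have [h1 h2 h3 h4] := rigid ht.
have [] := gram_identities (u t) (e t) (f t).
by rewrite (flex_dot_cst ht) h1 h2 h4.
Qed.

Lemma flex_tangent t : - eps < t < eps ->
  cross (u t) (f t) * cross (u t - e t) (f t) * derive1 E t +
  cross (e t) (u t) * cross (e t) (u t + f t) * derive1 F t = 0.
Proof.
move=> ht; have [_ <- <-] := flex_gramdet ht.
apply: (@gramdet_tangent _ eps) ht; try exact: smooth_on_dot.
by move=> s /flex_gramdet[].
Qed.

Lemma flex_auxetic_opposite : 0 < eps ->
  (forall t, - eps < t < eps -> 0 <= derive1 E t /\ 0 <= derive1 F t) ->
  derive1 E 0 != 0 \/ derive1 F 0 != 0 ->
  cross (e 0) (f 0) != 0 -> u 0 != 0 -> e 0 - u 0 != 0 ->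
  u 0 + f 0 != 0 -> u 0 + f 0 - e 0 != 0 ->
  cross (u 0) (f 0) * cross (u 0 - e 0) (f 0) *
  (cross (e 0) (u 0) * cross (e 0) (u 0 + f 0)) < 0.
Proof.
move=> eps0 mono nontriv ef u0 eu0 uf0 ufe0.
have h0 : - eps < 0 < eps by rewrite oppr_lt0 eps0.
have [_ d1 d2] := flex_gramdet h0; rewrite -d1 -d2.
have e0 : e 0 != 0 by apply: contra_neq ef => ->; rewrite /cross !mxE; ring.
have f0 : f 0 != 0 by apply: contra_neq ef => ->; rewrite /cross !mxE; ring.
apply: (@auxetic_opposite _ eps) => //; try exact: smooth_on_dot.
- by move=> t /flex_gramdet[].
- by rewrite gt_eqF // dot_gt0.
- by rewrite gt_eqF // dot_gt0.
- by rewrite d1 d2; exact: dgramdet_nonsingular.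
Qed.

End Flex.

End Deformations.

(** * The equivalence *)

Section Equivalence.
Variable R : realType.
Implicit Types u v e f z : 'cV[R]_2.

Section Joints.
Variables (p : vertex -> 'cV[R]_2) (per : Gamma -> 'cV[R]_2).
Hypothesis pl : placement p per.
Let u := p (VB 0) - p (VA 0).

(** Equivariance makes each bar vector the same along its orbit, so all of them are determined by
    [u] and the two generating periods. *)
Lemma placement_edges g :
  [/\ p (act g (VB 0)) - p (act g (VA 0)) = u,
      p (act g (VA gamma1)) - p (act g (VB 0)) = per gamma1 - u,
      p (act g (VB gamma2)) - p (act g (VA gamma1)) = u + per gamma2 - per gamma1 &
      p (act g (VA 0)) - p (act g (VB gamma2)) = - (u + per gamma2)].
Proof.
have [_ _ _ pact] := pl.
have C : p (VA gamma1) = p (VA 0) + per gamma1 by rewrite -pact /= addr0.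
have D : p (VB gamma2) = p (VB 0) + per gamma2 by rewrite -pact /= addr0.
by rewrite !pact C D /u; split; apply: cV2P; rewrite !mxE; ring.
Qed.

End Joints.

Lemma dotNN u : dot (- u) (- u) = dot u u.
Proof. by rewrite !dotE !mxE; ring. Qed.

Lemma dot_eq_dist u v w z : dot (v - u) (v - u) = dot (z - w) (z - w) ->
  dist u v = dist w z.
Proof. by rewrite /dist /enorm => ->. Qed.

Lemma placement_lengths (p p' : vertex -> 'cV[R]_2) (per per' : Gamma -> 'cV[R]_2)
    (u := p (VB 0) - p (VA 0))
    (u' := p' (VB 0) - p' (VA 0)) : placement p per -> placement p' per' ->
  [/\ dot u u = dot u' u',
      dot (per gamma1 - u) (per gamma1 - u) = dot (per' gamma1 - u') (per' gamma1 - u'),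
      dot (u + per gamma2 - per gamma1) (u + per gamma2 - per gamma1) =
        dot (u' + per' gamma2 - per' gamma1) (u' + per' gamma2 - per' gamma1) &
      dot (u + per gamma2) (u + per gamma2) = dot (u' + per' gamma2) (u' + per' gamma2)] ->
  forall x y, edge x y -> dist (p x) (p y) = dist (p' x) (p' y).
Proof.
move=> pl pl' [h1 h2 h3 h4] x y; case=> g; apply: dot_eq_dist;
  have [E1 E2 E3 E4] := placement_edges pl g;
  have [F1 F2 F3 F4] := placement_edges pl' g.
- by rewrite E1 F1.
- by rewrite E2 F2.
- by rewrite E3 F3.
- by rewrite E4 F4 !dotNN.
Qed.

Lemma auxetic_turns (A B C D : 'cV[R]_2) :
  quadrilateral A B C D -> cross (C - A) (D - B) != 0 ->
  has_local_auxetic_deformation A B C D ->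
  \prod_i turn (polygon4 A B C D) i < 0.
Proof.
move=> quad ef [eps [p [per [eps0 [pl sm [p0 per0] len] aux nontriv]]]].
have h0 : - eps < 0 < eps by rewrite oppr_lt0 eps0.
pose u t := p t (VB 0) - p t (VA 0).
have u0E : u 0 = B - A by rewrite /u !p0 /= /quad_per /= !mulr0z !addr0.
have e0E : per 0 gamma1 = C - A by rewrite per0 /quad_per /= mulr0z addr0.
have f0E : per 0 gamma2 = D - B by rewrite per0 /quad_per /= mulr0z add0r.
have [/dist_gt0 a /dist_gt0 b /dist_gt0 c /dist_gt0 d] := quad.
have rigid t : - eps < t < eps ->
  [/\ dot (u t) (u t) = dot (u 0) (u 0),
      dot (per t gamma1 - u t) (per t gamma1 - u t) =
        dot (per 0 gamma1 - u 0) (per 0 gamma1 - u 0),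
      dot (u t + per t gamma2 - per t gamma1) (u t + per t gamma2 - per t gamma1) =
        dot (u 0 + per 0 gamma2 - per 0 gamma1) (u 0 + per 0 gamma2 - per 0 gamma1) &
      dot (u t + per t gamma2) (u t + per t gamma2) =
        dot (u 0 + per 0 gamma2) (u 0 + per 0 gamma2)].
  move=> ht; have [E1 E2 E3 E4] := placement_edges (pl t ht) 0.
  have [F1 F2 F3 F4] := placement_edges (pl 0 h0) 0.
  have := dist_eq_dot (len t ht _ _ (edge_AB 0)); rewrite E1 F1.
  have := dist_eq_dot (len t ht _ _ (edge_BC 0)); rewrite E2 F2.
  have := dist_eq_dot (len t ht _ _ (edge_CD 0)); rewrite E3 F3.
  by have := dist_eq_dot (len t ht _ _ (edge_DA 0)); rewrite E4 F4 !dotNN.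
have se g : smooth_vec eps (fun t => per t g) by move=> i; exact: (sm i).2.
have dE t : (dgram per t 0 0 = derive1 (fun s => dot (per s gamma1) (per s gamma1)) t) *
            (dgram per t 1 1 = derive1 (fun s => dot (per s gamma2) (per s gamma2)) t).
  by rewrite !dgramE; split; congr (derive1 _ t); apply/funext => s; rewrite gramE.
rewrite turns_dgramdet -u0E -e0E -f0E.
apply: (flex_auxetic_opposite (se gamma1) (se gamma2) rigid eps0).
- by move=> t /aux /psd_diag_ge0; rewrite !dE.
(* The off-diagonal entries of [dgram] are zero because e.f is constant, so a nonzero derivative
   must show on the diagonal. *)
- rewrite -!dE; apply/orP; rewrite -negb_and; apply/negP => /andP[/eqP d00 /eqP d11].
  apply: nontriv; have off : derive1 (fun s => dot (per s gamma1) (per s gamma2)) 0 = 0.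
    exact/derive1_is_derive/derive_locally_cst/h0/(flex_dot_cst rigid).
  apply: mx2P; rewrite ?d00 ?d11 ?mxE // -[RHS]off; congr (derive1 _ 0);
    by apply/funext => s; rewrite gramE.
- by rewrite e0E f0E.
- by rewrite u0E.
- by rewrite e0E u0E opprB addrA subrK.
- by rewrite u0E f0E addrC addrA subrK -oppr_eq0 opprB.
- rewrite u0E f0E e0E; apply: contra_neq c => h; rewrite -[RHS]h.
  by apply: cV2P; rewrite !mxE; ring.
Qed.

(** * Moving the linkage by stretching the diagonal BD *)

Lemma smooth_on_sub (eps d : R) (h : R -> R) :
  d <= eps -> smooth_on eps h -> smooth_on d h.
Proof.
move=> de hh n t /andP[t1 t2]; apply: hh.
by rewrite (lt_le_trans t2 de) andbT (le_lt_trans _ t1) // lerN2.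
Qed.

Lemma smooth_on_gt0 (eps : R) (h : R -> R) : 0 < eps -> smooth_on eps h ->
  0 < h 0 -> exists d, [/\ 0 < d, d <= eps & forall t, - d < t < d -> 0 < h t].
Proof.
move=> eps0 hh h0.
have hc : {for (0 : R), continuous h}.
  apply: differentiable_continuous; apply/derivable1_diffP.
  by apply: (hh 0%N); rewrite oppr_lt0 eps0.
have /nbhs_ballP[d /= d0 hd] : \forall t \near (0 : R), 0 < h t.
  exact: cvgr_gt hc _ h0.
exists (Num.min d eps); rewrite lt_min d0 eps0 ge_min lexx orbT; split=> // t.
rewrite -ltr_norml lt_min => /andP[td _]; apply: hd.
by rewrite /ball /= sub0r normrN.
Qed.

Definition rot90 (u : 'cV[R]_2) : 'cV[R]_2 :=
  \col_i (if i == 0 then - u 1 0 else u 0 0).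

(* [zt t] is an intersection of the circles of radii |z| and |z + f| about the
   origin and -(1 + t) f: its component along f is rational in t, the one across
   f is a square root. *)
Lemma swing (z f : 'cV[R]_2) : cross z f != 0 ->
  exists eps zt, [/\ 0 < eps, eps <= 2^-1, smooth_vec eps zt, zt 0 = z &
    forall t, - eps < t < eps -> dot (zt t) (zt t) = dot z z /\
      dot (zt t + (1 + t) *: f) (zt t + (1 + t) *: f) = dot (z + f) (z + f)].
Proof.
move=> zf; have f0 : f != 0 by apply: contra_neq zf => ->; rewrite /cross !mxE; ring.
have F0 := dot_gt0 f0; set F := dot f f in F0.
have Fn0 : F != 0 by rewrite gt_eqF.
pose al := dot (z + f) (z + f) - dot z z.
have alE : al = 2 * dot z f + F by rewrite /al /F !dotE !mxE; ring.
have lag := lagrange_identity z f; rewrite -/F in lag.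
(* Subtracting the two circle equations is linear in [zt] and gives its coordinate [r] along f; the
   first circle then gives [q] as the square of the other coordinate. *)
pose r t : R := (al - F * ((1 + t) * (1 + t))) * (2 * F * (1 + t))^-1.
pose q t : R := dot z z * F^-1 + (- 1) * (r t * r t).
pose kap : R := - cross z f / F.
have kap0 : kap != 0 by rewrite mulf_neq0 ?oppr_eq0 ?invr_eq0.
have q0E : q 0 = kap * kap.
  have -> : q 0 = (dot z z * F - dot z f ^+ 2) / F ^+ 2.
    by rewrite /q /r alE; field.
  by rewrite -lag /kap; field.
(* [kap] is the coordinate of z across f. Factoring it out of the root selects the branch with s 0 =
   [kap], so that the motion starts at z. *)
pose s t : R := kap * Num.sqrt (q t * (kap * kap)^-1).
pose zt t : 'cV[R]_2 := r t *: f + s t *: rot90 f.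
have half_n0 (t : R) : - 2^-1 < t < 2^-1 -> 1 + t != 0.
  by move=> /andP[t1 t2]; rewrite gt_eqF //; lra.
have cst (eps c : R) : smooth_on eps (fun=> c) by exact: smooth_on_cst.
have s1 : smooth_on 2^-1 (fun t : R => 1 + t).
  exact: (smooth_onD (cst _ 1) (@smooth_on_id R _)).
have sr : smooth_on 2^-1 r.
  have sn : smooth_on 2^-1 (fun t => al - F * ((1 + t) * (1 + t))).
    apply: (smooth_on_eq (f := fun t => al + (- F) * ((1 + t) * (1 + t)))).
      by move=> t _; rewrite mulNr.
    exact: (smooth_onD (cst _ al) (smooth_onM (cst _ (- F)) (smooth_onM s1 s1))).
  have sd := smooth_onM (cst _ (2 * F)) s1.
  apply: (smooth_onM sn (smooth_onV _ sd)).
  by move=> t /half_n0 t0; rewrite !mulf_neq0.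
have sq : smooth_on 2^-1 q.
  exact: (smooth_onD (cst _ _) (smooth_onM (cst _ (- 1)) (smooth_onM sr sr))).
have kk : 0 < kap * kap by rewrite -expr2 exprn_even_gt0.
have half0 : 0 < 2^-1 :> R by rewrite invr_gt0.
have [|d [d0 dh qd]] := smooth_on_gt0 half0 sq; first by rewrite q0E.
have ss : smooth_on d s.
  apply: (smooth_onM (cst _ kap) (smooth_on_sqrt _ _)).
    by move=> t /qd qt; rewrite divr_gt0.
  exact: (smooth_onM (smooth_on_sub dh sq) (cst _ _)).
have s2 t : - d < t < d -> s t * s t = q t.
  move=> /qd qt; rewrite /s mulrACA -[Num.sqrt _ * _]expr2 sqr_sqrtr.
    by rewrite mulrCA mulfV ?mulr1 // gt_eqF.
  by rewrite divr_ge0 // ltW.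
exists d, zt; split; [exact: d0|exact: dh| | |].
- move=> i; apply: (smooth_on_eq (f := fun t => r t * f i 0 + s t * rot90 f i 0)).
    by move=> t _; rewrite [RHS]mxE [X in _ = X + _]mxE [X in _ = _ + X]mxE.
  exact: (smooth_onD (smooth_onM (smooth_on_sub dh sr) (cst _ _))
    (smooth_onM ss (cst _ _))).
- have r0 : r 0 = dot z f / F by rewrite /r alE; field.
  have s0 : s 0 = kap by rewrite /s q0E mulfV ?gt_eqF // sqrtr1 mulr1.
  have z0 : z 0 0 * F = dot z f * f 0 0 + cross z f * f 1 0.
    by rewrite /F /cross !dotE; ring.
  have z1 : z 1 0 * F = dot z f * f 1 0 - cross z f * f 0 0.
    by rewrite /F /cross !dotE; ring.
  rewrite /zt r0 s0 /kap; apply: cV2P; rewrite !mxE /=.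
    by rewrite -[RHS](mulfK Fn0) z0; field.
  by rewrite -[RHS](mulfK Fn0) z1; field.
- move=> t ht; have st := s2 t ht.
  have t0 : 1 + t != 0.
    by apply: half_n0; move: ht => /andP[? ?]; apply/andP; split; lra.
  have nz : dot (zt t) (zt t) = dot z z.
    have -> : dot (zt t) (zt t) = F * (r t * r t + s t * s t).
      by rewrite /zt /F !dotE !mxE /=; ring.
    by rewrite st /q; field.
  split => //.
  have -> : dot (zt t + (1 + t) *: f) (zt t + (1 + t) *: f) =
    dot (zt t) (zt t) + 2 * (1 + t) * (r t * F) + (1 + t) ^+ 2 * F.
    by rewrite /zt /F !dotE !mxE /=; ring.
  rewrite nz -[RHS](subrK (dot z z)) -/al /r; field.
  by rewrite Fn0 t0.
Qed.

(** * The periodic placement spanned by three moving vectors, with the joint B pinned *)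

Section Construction.
Variables (B : 'cV[R]_2) (eps : R) (u e f : R -> 'cV[R]_2).

Definition flex_per (t : R) (g : Gamma) : 'cV[R]_2 := e t *~ g.1 + f t *~ g.2.

Definition flex_pos (t : R) (x : vertex) : 'cV[R]_2 :=
  match x with
  | VA g => B - u t + flex_per t g
  | VB g => B + flex_per t g
  end.

Lemma flex_perD t g h : flex_per t (g + h) = flex_per t g + flex_per t h.
Proof.
case: g h => [m n] [m' n']; rewrite /flex_per /=.
by rewrite (mulrzDr (e t) m m') (mulrzDr (f t) n n') addrACA.
Qed.

Lemma flex_per_coord t g i :
  flex_per t g i 0 = e t i 0 * g.1%:~R + f t i 0 * g.2%:~R.
Proof.
rewrite /flex_per -(scaler_int g.1) -(scaler_int g.2) !mxE.
by congr (_ + _); exact: mulrC.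
Qed.

Lemma flex_placement t : cross (e t) (f t) != 0 -> placement (flex_pos t) (flex_per t).
Proof.
move=> ef; split.
- exact: flex_perD.
- move=> [m n] [m' n'] E.
  have E0 : flex_per t (m, n) 0 0 = flex_per t (m', n') 0 0 by rewrite E.
  have E1 : flex_per t (m, n) 1 0 = flex_per t (m', n') 1 0 by rewrite E.
  move: E0 E1; rewrite !flex_per_coord /= => E0 E1.
  (* Cramer's rule: the cross product with f isolates the first coefficient, the one with e the
     second. *)
  have hm : (m%:~R - m'%:~R) * cross (e t) (f t) = 0.
    transitivity ((e t 0 0 * m%:~R + f t 0 0 * n%:~R) * f t 1 0
      - (e t 1 0 * m%:~R + f t 1 0 * n%:~R) * f t 0 0
      - (e t 0 0 * m'%:~R + f t 0 0 * n'%:~R) * f t 1 0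
      + (e t 1 0 * m'%:~R + f t 1 0 * n'%:~R) * f t 0 0).
      by rewrite /cross; ring.
    by rewrite E0 E1; ring.
  have hn : (n%:~R - n'%:~R) * cross (e t) (f t) = 0.
    transitivity (e t 0 0 * (e t 1 0 * m%:~R + f t 1 0 * n%:~R)
      - e t 1 0 * (e t 0 0 * m%:~R + f t 0 0 * n%:~R)
      - e t 0 0 * (e t 1 0 * m'%:~R + f t 1 0 * n'%:~R)
      + e t 1 0 * (e t 0 0 * m'%:~R + f t 0 0 * n'%:~R)).
      by rewrite /cross; ring.
    by rewrite E0 E1; ring.
  move: hm hn => /eqP; rewrite mulf_eq0 (negPf ef) orbF subr_eq0 eqr_int => /eqP ->.
  by move=> /eqP; rewrite mulf_eq0 (negPf ef) orbF subr_eq0 eqr_int => /eqP ->.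
- exists (e t), (f t); split; first by rewrite free_cross.
  apply/seteqP; split=> x /=.
    by move=> [[m n] _ <-]; exists m, n.
  by move=> [m [n ->]]; exists (m, n).
- by move=> g [h|h] /=; rewrite flex_perD addrA [RHS]addrAC.
Qed.

Lemma smooth_flex : smooth_vec eps u -> smooth_vec eps e -> smooth_vec eps f ->
  forall i, (forall x, smooth_on eps (fun t => flex_pos t x i 0)) /\
            (forall g, smooth_on eps (fun t => flex_per t g i 0)).
Proof.
move=> su se sf i; have cst := @smooth_on_cst R eps.
have sp g : smooth_on eps (fun t => flex_per t g i 0).
  apply: (smooth_on_eq (f := fun t => e t i 0 * g.1%:~R + f t i 0 * g.2%:~R)).
    by move=> t _; rewrite flex_per_coord.
  exact: (smooth_onD (smooth_onM (se i) (cst _)) (smooth_onM (sf i) (cst _))).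
split; last exact: sp.
case=> g.
  apply: (smooth_on_eq (f := fun t => B i 0 + (- 1) * u t i 0 + flex_per t g i 0)).
    by move=> t _; rewrite /flex_pos !mxE mulN1r.
  exact: (smooth_onD (smooth_onD (cst _) (smooth_onM (cst _) (su i))) (sp g)).
apply: (smooth_on_eq (f := fun t => B i 0 + flex_per t g i 0)).
  by move=> t _; rewrite /flex_pos !mxE.
exact: (smooth_onD (cst _) (sp g)).
Qed.

End Construction.

Lemma smooth_vecD eps (y z : R -> 'cV[R]_2) : smooth_vec eps y ->
  smooth_vec eps z -> smooth_vec eps (fun t => y t + z t).
Proof.
move=> sy sz i; apply: smooth_on_eq (smooth_onD (sy i) (sz i)).
by move=> t _; rewrite mxE.
Qed.

Lemma smooth_vecN eps (y : R -> 'cV[R]_2) : smooth_vec eps y ->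
  smooth_vec eps (fun t => - y t).
Proof.
move=> sy i; apply: smooth_on_eq (smooth_onM (@smooth_on_cst R _ (- 1)) (sy i)).
by move=> t _; rewrite mxE mulN1r.
Qed.

Lemma smooth_on_cross eps (y z : R -> 'cV[R]_2) : smooth_vec eps y ->
  smooth_vec eps z -> smooth_on eps (fun t => cross (y t) (z t)).
Proof.
move=> hy hz; apply: (smooth_on_eq (f := fun t =>
  y t 0 0 * z t 1 0 + (- 1) * (y t 1 0 * z t 0 0))).
  by move=> t _; rewrite mulN1r.
exact: (smooth_onD (smooth_onM (hy 0) (hz 1))
  (smooth_onM (@smooth_on_cst R _ (- 1)) (smooth_onM (hy 1) (hz 0)))).
Qed.

Lemma smooth_vec_sub (eps d : R) (z : R -> 'cV[R]_2) :
  d <= eps -> smooth_vec eps z -> smooth_vec d z.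
Proof. by move=> de hz i; exact: smooth_on_sub de (hz i). Qed.

(** BD is stretched to (1 + t) BD while A and C swing about B and D on circles of fixed radii. Then
    F grows by construction, and the tangent relation with partials of opposite signs makes E grow
    too. *)
Lemma turns_auxetic (A B C D : 'cV[R]_2) : cross (C - A) (D - B) != 0 ->
  \prod_i turn (polygon4 A B C D) i < 0 -> has_local_auxetic_deformation A B C D.
Proof.
move=> ef; rewrite turns_dgramdet => neg.
set f0 := D - B in ef neg *.
(* A nonzero product of turns puts A and C off the line BD, as [swing] requires. *)
have [uf vf] : cross (B - A) f0 != 0 /\ cross (B - C) f0 != 0.
  have : cross (B - A) f0 * cross (B - A - (C - A)) f0 *
    (cross (C - A) (B - A) * cross (C - A) (B - A + f0)) != 0 by rewrite lt_eqF.
  rewrite !mulf_eq0 !negb_or => /andP[/andP[h1 h2] _]; split => //.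
  by move: h2; congr (cross _ _ != 0); apply: cV2P; rewrite !mxE; ring.
have [d1 [u [d10 d1h su u0 ulen]]] := swing uf.
have [d2 [v [d20 d2h sv v0 vlen]]] := swing vf.
pose f (t : R) := (1 + t) *: f0.
(* [u] continues AB and [v] continues CB, so their difference continues AC. *)
pose e t := u t - v t.
have e0E : e 0 = C - A by rewrite /e u0 v0; apply: cV2P; rewrite !mxE; ring.
have f0E : f 0 = f0 by rewrite /f addr0 scale1r.
pose d := Num.min d1 d2.
have d0 : 0 < d by rewrite lt_min d10 d20.
have {}su : smooth_vec d u by apply: smooth_vec_sub su; rewrite ge_min lexx.
have {}sv : smooth_vec d v by apply: smooth_vec_sub sv; rewrite ge_min lexx orbT.
have sf : smooth_vec d f.
  move=> i; apply: smooth_on_eq (smooth_onM (smooth_onD (@smooth_on_cst R _ 1)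
    (@smooth_on_id R _)) (@smooth_on_cst R _ (f0 i 0))).
  by move=> t _; rewrite [RHS]mxE.
have se : smooth_vec d e := smooth_vecD su (smooth_vecN sv).
have suf := smooth_vecD su sf.
pose h t := - (cross (u t) (f t) * cross (u t - e t) (f t) *
  (cross (e t) (u t) * cross (e t) (u t + f t))).
have sh : smooth_on d h.
  have sc := smooth_on_cross.
  have H := smooth_onM (@smooth_on_cst R _ (- 1)) (smooth_onM (smooth_onM (sc _ _ _ su sf)
    (sc _ _ _ (smooth_vecD su (smooth_vecN se)) sf))
    (smooth_onM (sc _ _ _ se su) (sc _ _ _ se suf))).
  by apply: smooth_on_eq H => t _; rewrite mulN1r.
have [|d3 [d30 d3d hpos]] := smooth_on_gt0 d0 sh.
  by rewrite /h oppr_gt0 e0E f0E u0.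
(* Independence of the periods is stated as positivity of a square, an open condition that persists
   for small t. *)
have [|d4 [d40 d4d wpos]] := smooth_on_gt0 d0
    (smooth_onM (smooth_on_cross se sf) (smooth_on_cross se sf)).
  by rewrite e0E f0E -expr2 exprn_even_gt0.
pose eps := Num.min d3 d4.
have eps0 : 0 < eps by rewrite lt_min d30 d40.
have epsd : eps <= d by rewrite ge_min d3d.
have inI (k : R) t : eps <= k -> - eps < t < eps -> - k < t < k.
  by move=> ek; rewrite -!ltr_norml => ht; exact: lt_le_trans ht ek.
have rigid t : - eps < t < eps ->
  [/\ dot (u t) (u t) = dot (u 0) (u 0),
      dot (e t - u t) (e t - u t) = dot (e 0 - u 0) (e 0 - u 0),
      dot (u t + f t - e t) (u t + f t - e t) =
        dot (u 0 + f 0 - e 0) (u 0 + f 0 - e 0) &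
      dot (u t + f t) (u t + f t) = dot (u 0 + f 0) (u 0 + f 0)].
  move=> ht.
  have [l1 l2] : dot (u t) (u t) = dot (B - A) (B - A) /\
      dot (u t + f t) (u t + f t) = dot (B - A + f0) (B - A + f0).
    by apply: ulen; apply: inI ht; apply: le_trans epsd _; rewrite ge_min lexx.
  have [l3 l4] : dot (v t) (v t) = dot (B - C) (B - C) /\
      dot (v t + f t) (v t + f t) = dot (B - C + f0) (B - C + f0).
    by apply: vlen; apply: inI ht; apply: le_trans epsd _; rewrite ge_min lexx orbT.
  have eu s : e s - u s = - v s by rewrite /e addrAC subrr add0r.
  have ufe s : u s + f s - e s = v s + f s by rewrite /e opprB addrC addrA subrK.
  by rewrite !eu !dotNN !ufe l1 l2 l3 l4 u0 v0 f0E.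
have {}hpos t : - eps < t < eps -> 0 < h t.
  by move=> ht; apply: hpos; apply: inI ht; rewrite ge_min lexx.
have {}wpos t : - eps < t < eps -> cross (e t) (f t) != 0.
  move=> ht; have : 0 < cross (e t) (f t) * cross (e t) (f t).
    by apply: wpos; apply: inI ht; rewrite ge_min lexx orbT.
  by apply: contraTneq => ->; rewrite mul0r ltxx.
have {}su := smooth_vec_sub epsd su.
have {}se := smooth_vec_sub epsd se.
have {}sf := smooth_vec_sub epsd sf.
have pl t : - eps < t < eps -> placement (flex_pos B u e f t) (flex_per e f t).
  by move=> /wpos; exact: flex_placement.
have h0 : - eps < 0 < eps by rewrite oppr_lt0 eps0.
have g1 t : flex_per e f t gamma1 = e t by rewrite /flex_per /= mulr0z addr0.
have g2 t : flex_per e f t gamma2 = f t by rewrite /flex_per /= mulr0z add0r.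
have dE t : [/\ dgram (flex_per e f) t 0 0 = derive1 (fun s => dot (e s) (e s)) t,
    dgram (flex_per e f) t 1 1 = derive1 (fun s => dot (f s) (f s)) t,
    dgram (flex_per e f) t 0 1 = derive1 (fun s => dot (e s) (f s)) t &
    dgram (flex_per e f) t 1 0 = derive1 (fun s => dot (e s) (f s)) t].
  by rewrite !dgramE; split; congr (derive1 _ t); apply/funext => s;
    rewrite gramE ?g1 ?g2.
have F_gt0 t : - eps < t < eps -> 0 < derive1 (fun s => dot (f s) (f s)) t.
  move=> ht; have d1t := is_deriveD_fun (is_derive_cst (1 : R) t 1) (is_derive_id t (1 : R)).
  have := is_deriveM_fun (is_deriveM_fun d1t d1t) (is_derive_cst (dot f0 f0) t 1).
  move=> /derive1_is_derive; rewrite (_ : (fun s => _) = (fun s => dot (f s) (f s))).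
    move=> ->; rewrite mulr0 !add0r !mulr1 mulr_gt0 ?dot_gt0 //.
      by apply: contra_neq ef => ->; rewrite /cross !mxE; ring.
    have : - 2^-1 < t < 2^-1.
      by apply: inI ht; apply: le_trans epsd _; rewrite ge_min d1h.
    by move=> /andP[? ?]; rewrite /cst; lra.
  by apply/funext => s; rewrite /cst /f !dotE !mxE; ring.
have E_gt0 t : - eps < t < eps -> 0 < derive1 (fun s => dot (e s) (e s)) t.
  move=> ht; have := flex_tangent se sf rigid ht; have := hpos t ht; rewrite /h.
  move: (F_gt0 t ht).
  move: (cross (u t) _ * _) (cross (e t) (u t) * _) => P Q.
  move: (derive1 _ t) (derive1 _ t) => x y x0 PQ T.
  rewrite ltNge; apply/negP => y0.
  (* Multiplied by P, the tangent relation would be a sum of a nonpositive term and a negative one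
     if E' were not positive. *)
  have : P ^+ 2 * x + P * Q * y = 0 by rewrite -[RHS](mulr0 P) -T; ring.
  have : P ^+ 2 * x <= 0 by rewrite mulr_ge0_le0 ?sqr_ge0.
  have : P * Q * y < 0 by rewrite nmulr_rlt0 // -oppr_gt0.
  lra.
have joints s : flex_pos B u e f s (VB 0) - flex_pos B u e f s (VA 0) = u s.
  by rewrite /flex_pos; apply: cV2P; rewrite !mxE; ring.
clearbody h e f.
exists eps, (flex_pos B u e f), (flex_per e f); split; [exact: eps0| | |].
- split.
  + exact: pl.
  + exact: smooth_flex.
  + have per0 : flex_per e f 0 =1 quad_per A B C D.
      by move=> g; rewrite /flex_per e0E f0E.
    split; last exact: per0.
    case=> g /=; rewrite per0 ?u0 //.
    by congr (_ + _); rewrite opprB addrC subrK.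
  + move=> t ht; apply: placement_lengths (pl t ht) (pl 0 h0) _.
    by rewrite !joints !g1 !g2; exact: rigid.
- move=> t ht; have [E00 E11 E01 E10] := dE t.
  have off : derive1 (fun s => dot (e s) (f s)) t = 0.
    exact: derive1_is_derive (derive_locally_cst (flex_dot_cst rigid) ht).
  by apply: psd_diag; rewrite ?E00 ?E11 ?E01 ?E10 // ltW ?E_gt0 ?F_gt0.
- move=> Z; have [_ E11 _ _] := dE 0; have := F_gt0 0 h0.
  by rewrite -E11 Z mxE ltxx.
Qed.

End Equivalence.

Theorem theorem5 (R : realType) (A B C D : 'cV[R]_2)
    (quad : quadrilateral A B C D) (gen : generic A B C D)
    (diag_free : free [:: C - A; D - B]) :
  has_local_auxetic_deformation A B C D <-> pseudotriangle (polygon4 A B C D).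
Proof.
rewrite free_cross in diag_free; split.
  by move=> /(auxetic_turns quad diag_free) /(pseudotriangle4 quad diag_free).
by move=> /(pseudotriangle4 quad diag_free) /(turns_auxetic diag_free).
Qed.
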